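(* Let $P$ be a little hybrid path that has at least one special step and whose leftmost special step is immediately preceded by an upstep, and let $c$ and $c+1$ be the positions of this upstep and this special step, so that $(c,c+1)$ is a special edge of the hybrid matching $M(P)$. Let $(a,b)$ be the edge of $M(P)$ that immediately nests $(c,c+1)$. Then the hybrid matching $M(e(P))$ is obtained from $M(P)$ by replacing the edges $(c,c+1)$ and $(a,b)$ with the (ordinary) edges $(c,b)$ and $(a,c+1)$, all other edges being unchanged.
   Context: **Paths.** All lattice paths of length $2n$ start at $(0,0)$, end at $(2n,0)$, never go below the $x$-axis, and consist of upsteps U $=(1,1)$, downsteps $(1,-1)$, and double horizontal steps HH $=(2,0)$ (treated as indivisible ''horizontal steps'', occupying two consecutive positions). Each downstep is either ordinary (D) or labeled ''special'' (d). The unit horizontal positions $1,\dots,2n$ index the steps: an upstep or downstep going from $x=i-1$ to $x=i$ is at position $i$, and a horizontal step from $x=i-1$ to $x=i+1$ occupies positions $i,i+1$. An even-special Dyck path is a Dyck path (no horizontal steps) in which an arbitrary subset of the downsteps leaving from even height are labeled special. **Matching upstep.** The upstep matching a downstep $d$ is the rightmost upstep to the left of $d$ that ends at the height from which $d$ leaves. **The map $e$.** If a path has no special steps, $e$ leaves it unchanged. Otherwise take the leftmost special step $s$. (Flatten) If $s$ is immediately preceded by an upstep, replace that upstep and $s$ by one horizontal step HH. (Slide) If $s$ is immediately preceded by a downstep $d$ (necessarily ordinary), let $u$ be the upstep matching $d$ and $Q$ the (possibly empty) subpath strictly between $u$ and $d$; replace the portion $u\,Q\,d\,s$ by HH $Q$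 D, with D an ordinary downstep. For little hybrid paths these are the only cases that occur. **Little hybrid paths.** The smallest set of paths containing all even-special Dyck paths and closed under $e$. **Hybrid matching $M(P)$.** For a little hybrid path $P$ of length $2n$, $M(P)$ is a perfect matching of $\{1,\dots,2n\}$ with some edges labeled special, constructed by reading $P$ from left to right: an upstep at position $i$ makes $i$ an opening vertex; a downstep at position $i$ joins $i$ to the nearest (most recent) not yet matched opening vertex to its left; a horizontal step at positions $i,i+1$ joins $i+1$ to the nearest not yet matched opening vertex to the left of $i$, and makes $i$ an opening vertex (so the two edges at $i,i+1$ cross). An edge is written $(i,j)$ with $i<j$. An edge is special if its right endpoint is the position of a special downstep, otherwise ordinary. **Nesting.** Edge $(a,b)$ nests edge $(c,d)$ if $a<c<d<b$. Edge $\alpha$ immediately nests edge $\beta$ if $\alpha$ nests $\beta$ and any other edge that nests $\beta$ also nests $\alpha$. *)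

(* Defs.v *)
From mathcomp Require Import all_boot all_order all_algebra.
From mathcomp Require Import finmap.

Set Implicit Arguments.
Unset Strict Implicit.
Unset Printing Implicit Defensive.

(* [Special] is the downstep labelled d; [HH] is one indivisible step of
   width 2. *)
Inductive step : Type := Up | Down | Special | HH.

Definition is_up (s : step) : bool := if s is Up then true else false.
Definition is_special (s : step) : bool := if s is Special then true else false.
Definition is_horizontal (s : step) : bool := if s is HH then true else false.

Definition width (s : step) : nat := if s is HH then 2 else 1.

Definition rise (s : step) : int :=
  match s with Up => 1%R | Down | Special => (-1)%R | HH => 0%R end.

(* Steps are indexed from 0, so step [i] goes from the point
   [(abscissa p i, height p i)] to [(abscissa p i.+1, height p i.+1)]. *)
Definition abscissa (p : seq step) (i : nat) : nat :=
  \sum_(s <- take i p) width s.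

Definition height (p : seq step) (i : nat) : int :=
  (\sum_(s <- take i p) rise s)%R.

(* For [HH] this is the first of the two positions that it occupies. *)
Definition position (p : seq step) (i : nat) : nat := (abscissa p i).+1.

Definition lattice_path (n : nat) (p : seq step) : Prop :=
  [/\ abscissa p (size p) = n.*2,
      height p (size p) = 0%R
    & forall i : nat, (0 <= height p i)%R].

Definition even_special_dyck (n : nat) (p : seq step) : Prop :=
  [/\ lattice_path n p,
      ~~ has is_horizontal p
    & forall i : nat, onth p i = Some Special -> (2 %| height p i)%Z].

Definition matching_upstep (p : seq step) (i : nat) : option nat :=
  ohead [seq j <- rev (iota 0 i) | is_up (nth Down p j)
                                   & height p j.+1 == height p i].

(* The paths on which neither a flattening nor a sliding applies are left
   unchanged; the leftmost special step has index [k.+1]. *)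
Definition e (p : seq step) : seq step :=
  if ~~ has is_special p then p else
  if find is_special p is k.+1 then
    match onth p k with
    | Some Up => take k p ++ HH :: drop k.+2 p
    | Some Down =>
        if matching_upstep p k is Some j then
          take j p ++ HH :: drop j.+1 (take k p) ++ Down :: drop k.+2 p
        else p
    | _ => p
    end
  else p.

Inductive little_hybrid (n : nat) : seq step -> Prop :=
  | little_hybrid_dyck p : even_special_dyck n p -> little_hybrid n p
  | little_hybrid_e p : little_hybrid n p -> little_hybrid n (e p).

(* [(i, j, t)] is the edge [(i, j)], which is special when [t = true]. *)
Definition edge : Type := (nat * nat * bool)%type.

(* [x] is the current abscissa and [opn] lists the opening vertices that are
   not yet matched, most recent first.  A step that finds no vertex to join,
   which does not happen on a little hybrid path, adds no edge. *)
Fixpoint matching_from (x : nat) (opn : seq nat) (p : seq step) : seq edge :=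
  match p with
  | [::] => [::]
  | Up :: q => matching_from x.+1 (x.+1 :: opn) q
  | HH :: q =>
      if opn is a :: opn' then
        (a, x.+2, false) :: matching_from x.+2 (x.+1 :: opn') q
      else matching_from x.+2 [:: x.+1] q
  | s :: q =>
      if opn is a :: opn' then
        (a, x.+1, is_special s) :: matching_from x.+1 opn' q
      else matching_from x.+1 [::] q
  end.

Definition hybrid_matching (p : seq step) : {fset edge} :=
  [fset al in matching_from 0 [::] p]%fset.

Definition nests (al be : edge) : Prop :=
  [/\ al.1.1 < be.1.1, be.1.1 < be.1.2 & be.1.2 < al.1.2].

Definition immediately_nests (M : {fset edge}) (al be : edge) : Prop :=
  [/\ al \in M, be \in M, nests al be
    & forall ga : edge, ga \in M -> ga <> al -> nests ga be -> nests ga al].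

(* Main.v *)
(** A horizontal step pops the most recent opening vertex and pushes a new one,
    so flattening U d into HH only exchanges the names [a] and [c] of the top of
    the stack read by the remainder of the path: the edge [(a, b)] becomes
    [(c, b)] and [(a, c+1)] is new.  Two facts about little hybrid paths, both
    stable under [e], make this work: a special step leaves from an even height,
    so [a] exists and [(a, b)] is ordinary, its right endpoint being reached
    from an odd height; and no horizontal step lies at height 0. *)
Require Import Defs.
From mathcomp Require Import all_boot all_order all_algebra.
From mathcomp Require Import finmap zify.

Set Implicit Arguments.
Unset Strict Implicit.
Unset Printing Implicit Defensive.

(** * Heights along a path *)

(* [None] if the path, started at height [h], goes below the axis, has a
   horizontal step at height 0, or has a special step leaving from odd height. *)
Fixpoint end_height (h : nat) (p : seq step) : option nat :=
  match p with
  | [::] => Some h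
  | Up :: q => end_height h.+1 q
  | Down :: q => if 0 < h then end_height h.-1 q else None
  | Special :: q => if (0 < h) && ~~ odd h then end_height h.-1 q else None
  | HH :: q => if 0 < h then end_height h q else None
  end.

Lemma end_height_cat h p q :
  end_height h (p ++ q) = obind (end_height^~ q) (end_height h p).
Proof. by elim: p h => [|[] p IH] h //=; case: ifP. Qed.

Lemma height0 p : height p 0 = 0%R.
Proof. by rewrite /height take0 big_nil. Qed.

Lemma height_cons s p i : height (s :: p) i.+1 = (rise s + height p i)%R.
Proof. by rewrite /height /= big_cons. Qed.

Lemma height_cat p q i :
  height (p ++ q) (size p + i) = (height p (size p) + height q i)%R.
Proof. by rewrite /height takeD take_size_cat // drop_size_cat // big_cat take_size. Qed.

Lemma end_height_height h p h' :
  end_height h p = Some h' -> (h%:Z + height p (size p))%R = Posz h'.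
Proof.
elim: p h => [|s p IH] h /=; first by rewrite height0 => -[->]; lia.
rewrite height_cons.
by case: s => /=; [|case: ifP => // ?..] => /IH <-; lia.
Qed.

(** An arbitrary starting height [h] is what lets the induction pass to the tail of the path; parity
    is tested on [h] plus the relative height. *)
Lemma end_height_dyck p h h' :
    ~~ has is_horizontal p ->
    (forall i, (0 <= h%:Z + height p i)%R) ->
    (forall i, onth p i = Some Special -> (2 %| (h%:Z + height p i)%R)%Z) ->
    (h%:Z + height p (size p))%R = Posz h' ->
  end_height h p = Some h'.
Proof.
elim: p h => [|s p IH] h /= nohh ge0 even; first by rewrite height0 => ?; congr Some; lia.
have ge1 := ge0 1; have even0 := even 0; move: ge1 even0.
rewrite !height_cons !height0 => ge1 even0 end0.
have {}IH g : Posz g = (h%:Z + rise s)%R -> end_height g p = Some h'.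
  move=> gE; apply: IH.
  - by move: nohh; rewrite negb_or => /andP[].
  - by move=> i; have := ge0 i.+1; rewrite height_cons; lia.
  - by move=> i /(even i.+1); rewrite height_cons gE GRing.addrA.
  - by rewrite gE -GRing.addrA.
case: s even0 ge1 {even ge0 end0} nohh IH => //= even0 ge1 _ IH.
- by apply: IH; lia.
- by rewrite (_ : 0 < h) ?IH //; lia.
- have := even0 erefl; rewrite GRing.addr0 => ev.
  by rewrite (_ : (0 < h) && ~~ odd h) ?IH //; lia.
Qed.

(** * Stability of the height condition under [e] *)

Lemma ohead_filter_rev_iota (a : pred nat) k j :
    ohead [seq i <- rev (iota 0 k) | a i] = Some j ->
  [/\ j < k, a j & forall i, j < i < k -> ~~ a i].
Proof.
elim: k => [|k IH] //.
rewrite -addn1 iotaD rev_cat /= add0n addn1; case: ifP => [ak [<-]|ank /IH[jk aj nai]].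
  by split=> // i; lia.
split=> //; first by lia.
by move=> i; case: (eqVneq i k) => [->|ik] ij; [rewrite ank | apply: nai; lia].
Qed.

(* Such a path stays above its final height, so it can be lowered by one, as a
   slide does with [Q]. *)
Lemma end_height_lower q m h :
    0 < h -> ~~ has is_special q ->
    (forall i, is_up (nth Down q i) -> (m%:Z + height q i.+1)%R != Posz h.+1) ->
    end_height m q = Some h.+1 ->
  h < m /\ end_height m.-1 q = Some h.
Proof.
move=> h0; elim: q m => [|s q IH] m /=; first by move=> _ _ [->].
rewrite negb_or => /andP[nspec nspecq] noup.
have {}IH g : Posz g = (m%:Z + rise s)%R -> end_height g q = Some h.+1 ->
    h < g /\ end_height g.-1 q = Some h.
  move=> gE; apply: IH => // i /(noup i.+1).
  by rewrite height_cons gE GRing.addrA.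
have {noup} := noup 0; rewrite height_cons height0 /=.
case: s nspec IH => //= _ IH noup0.
- move=> /IH[|hm]; first by lia.
  (* An upstep is the only step that could start at or below [h] and end above it; not ending at
     [h.+1], it starts above [h]. *)
  have := noup0 isT => ? /=; have -> : m.-1.+1 = m by lia.
  by split=> //; lia.
- case: ifP => // m0 /IH[|hm ->]; first by lia.
  by split; [lia | rewrite (_ : 0 < m.-1) //; lia].
- case: ifP => // m0 /IH[|hm ->]; first by lia.
  by split=> //; rewrite (_ : 0 < m.-1) //; lia.
Qed.

Lemma leftmost_special p k s :
    has is_special p -> find is_special p = k.+1 -> onth p k = Some s ->
  [/\ p = take k p ++ s :: Special :: drop k.+2 p,
      size (take k p) = k & ~~ has is_special (take k p)].
Proof.
move=> hs fk pk; have nk := onth_nth Down _ _ _ pk.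
have kp : k < size p by rewrite -onthTE pk.
have k1p : k.+1 < size p by rewrite -fk -has_find.
have := nth_find Down hs; rewrite fk => spec.
split; last 2 first.
- by rewrite size_takel // ltnW.
- by rewrite has_take // fk ltnNge leqnSn.
rewrite -{1}(cat_take_drop k p) (drop_nth Down) // (drop_nth Down k1p) nk.
by case: (nth Down p k.+1) spec.
Qed.

(** Both moves keep the heights of all later steps. A slide lowers [Q] by one: no parity is
    affected, since [Q] precedes the leftmost special step, and [Q] stays high enough, since [u] is
    the last upstep to reach the height from which [d] leaves. *)
Lemma end_height_e p : end_height 0 p = Some 0 -> end_height 0 (e p) = Some 0.
Proof.
move=> p0; rewrite /e; case: ifP => // /negbFE hs.
case fk: (find _ _) => [|k] //; case pk: (onth p k) => [s|] //.
have [pE sk nsk] := leftmost_special hs fk pk.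
case: s pk pE => // pk pE.
  (* Flattening: the special step leaves from the even height [h.+1], so the new [HH] lies at the
     odd, hence positive, height [h]. *)
  move: p0; rewrite {1}pE !end_height_cat; case: end_height => //= h.
  by case: ifP => //= /[!negbK] oh; rewrite odd_gt0.
case mj: (matching_upstep p k) => [j|] //.
have [jk /andP[upj /eqP hj] noup] := ohead_filter_rev_iota mj.
have kp : k < size p by rewrite -sk {2}pE size_cat /=; lia.
have jp := ltn_trans jk kp.
set A := take j p; set Q := drop j.+1 (take k p); set B := drop k.+2 p.
have sA : size A = j by rewrite size_takel // ltnW.
have tkE : take k p = A ++ Up :: Q.
  rewrite -{1}(cat_take_drop j (take k p)) take_takel ?(ltnW jk) //.
  rewrite (drop_nth Down) ?sk // nth_take //.
  by case: (nth Down p j) upj.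
have sQ : j + (size Q).+1 = k by rewrite -[RHS]sk tkE size_cat sA.
move: p0; rewrite {1}pE tkE -catA /= !end_height_cat.
case Ag: (end_height 0 A) => [g|] //=.
rewrite end_height_cat; case Qm: (end_height g.+1 Q) => [m|] //=.
have heightE i : i <= size Q -> height p (j + i.+1) = (g.+1%:Z + height Q i)%R.
  move=> iQ; rewrite pE tkE -catA -sA height_cat /= height_cons.
  have := end_height_height Ag; rewrite GRing.add0r => -> /=.
  rewrite (_ : height (Q ++ _) i = height Q i) ?/height ?takel_cat //; lia.
have hk : height p k = Posz g.+1 by rewrite -hj -addn1 heightE // height0; lia.
(* The matching condition [hj] says that [Q] returns to the height at which it starts. *)
have mE : m = g.+1.
  have := end_height_height Qm; have := heightE _ (leqnn _); rewrite sQ hk.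
  by lia.
case: ifP => // _; case: ifP => // /andP[m1 om].
subst m => B0; have [||i upi|_ /= Qg] := @end_height_lower Q g.+1 g _ _ _ Qm.
- by lia.
- by move: nsk; rewrite tkE has_cat /= negb_or => /andP[].
- have iQ : i < size Q.
    by rewrite ltnNge; apply/negP => ?; move: upi; rewrite nth_default.
  have /noup : j < j + i.+1 < k by lia.
  have -> : nth Down p (j + i.+1) = nth Down Q i.
    rewrite pE nth_cat tkE size_cat /= sA ltn_add2l ltnS iQ nth_cat sA.
    by rewrite ltnNge leq_addr /= addKn.
  by rewrite upi /= -addnS heightE // hk.
have g0 : 0 < g by lia.
by rewrite g0 end_height_cat Qg /= g0.
Qed.

Lemma little_hybrid_end_height n p :
  little_hybrid n p -> end_height 0 p = Some 0.
Proof.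
elim=> {p} [p [[_ end0 ge0] nohh even]|p _ IH]; last exact: end_height_e.
by apply: end_height_dyck => // [i|i|]; rewrite GRing.add0r //; apply: even.
Qed.

(** * The matching as the run of a stack *)

(** Each edge is emitted when its right endpoint is read, so the list of edges is ordered by right
    endpoint. *)
Lemma matching_from_right x s p :
  path ltn x [seq al.1.2 | al <- matching_from x s p].
Proof.
have wk y z l : y <= z -> path ltn z l -> path ltn y l.
  by case: l => //= u l yz /andP[zu ->]; rewrite (leq_ltn_trans yz zu).
elim: p x s => [|[] p IH] x [|a s] //=; rewrite ?ltnS ?leqnn ?leqnSn ?IH //.
all: by apply: wk (IH _ _); lia.
Qed.

Lemma matching_from_left x s p al :
  al \in matching_from x s p -> (al.1.1 \in s) || (x < al.1.1).
Proof.
case: al => [[u v] t] /=.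
elim: p x s => [|[] p IH] x [|a s] //=; rewrite ?inE.
all: try (case/orP=> [/eqP[-> _ _]|]; first by rewrite eqxx).
all: by move=> /IH; rewrite ?inE; try case: (u \in s); lia.
Qed.

(** The stack size equals the current height, so no step of an accepted prefix lacks a vertex to
    join. The prefix then acts on the rest only through the stack [s'], which decreases from its
    top. *)
Lemma matching_from_prefix p x s h :
    end_height (size s) p = Some h -> path gtn x.+1 s ->
  exists E s', [/\ size s' = h, path gtn (x + \sum_(t <- p) width t).+1 s'
    & forall q, matching_from x s (p ++ q) =
        E ++ matching_from (x + \sum_(t <- p) width t) s' q].
Proof.
have wk y z l : y <= z -> path gtn y l -> path gtn z l.
  by case: l => //= u l yz /andP[uy ->]; rewrite (leq_trans uy yz).
elim: p x s => [|t p IH] x s /=.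
  by move=> [<-] ps; exists [::], s; split=> // [|q]; rewrite big_nil addn0.
rewrite big_cons addnA.
case: t => /=.
- move=> /(IH x.+1 (x.+1 :: s)) H ps; rewrite addn1; apply: H => /=.
  by rewrite ltnSn.
- case: s => //= a s /(IH x.+1) H /andP[ax ps].
  case: H => [|E [s' [? ? H]]]; first by apply: wk ps; lia.
  exists ((a, x.+1, false) :: E), s'; rewrite addn1; split=> // q.
  by rewrite /= H.
- case: s => //= a s; case: ifP => // _ /(IH x.+1) H /andP[ax ps].
  case: H => [|E [s' [? ? H]]]; first by apply: wk ps; lia.
  exists ((a, x.+1, true) :: E), s'; rewrite addn1; split=> // q.
  by rewrite /= H.
- case: s => //= a s /(IH x.+2 (x.+1 :: s)) H /andP[ax ps].
  case: H => [|E [s' [? ? H]]].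
    by rewrite /= ltnS leqnSn; apply: wk ps; lia.
  exists ((a, x.+2, false) :: E), s'; rewrite addn2; split=> // q.
  by rewrite /= H.
Qed.

(** The name [a] on the stack is only copied into the edge that pops it, so [b], [L1] and [L2] do
    not depend on [a]. The list [r] holds the vertices opened above [a] during the induction. *)
Lemma matching_from_pop p x x0 r s :
    end_height (size r + (size s).+1) p = Some 0 -> ~~ odd (size s) ->
    x0 <= x -> all (ltn x0) r ->
  exists L1 b L2,
    [/\ forall a, matching_from x (r ++ a :: s) p = L1 ++ (a, b, false) :: L2,
        forall al, al \in L1 -> x0 < al.1.1
      & forall al, al \in L2 -> (al.1.1 \in s) || (x0 < al.1.1)].
Proof.
move=> + os; elim: p x r => [|t p IH] x r /=; first by rewrite addnS.
have leftL2 y s' al : x0 <= y -> {subset s' <= [predU s & ltn x0]} ->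
    al \in matching_from y s' p -> (al.1.1 \in s) || (x0 < al.1.1).
  move=> xy sub /matching_from_left/orP[/sub|]; first by rewrite inE.
  by move=> ?; apply/orP; right; apply: leq_ltn_trans xy _.
case: t.
- move=> H xx r0; apply: (IH x.+1 (x.+1 :: r)) => //=; first exact: leqW.
  by rewrite ltnS xx.
- rewrite addnS /=; case: r => [|v r] /= H xx.
    move=> _; exists [::], x.+1, (matching_from x.+1 s p); split=> // al.
    by apply: leftL2 => [|v vs]; [exact: leqW | rewrite inE vs].
  move=> /andP[xv r0].
  have [|L1 [b [L2 [HL H1 H2]]]] := IH x.+1 r _ (leqW xx) r0.
    by rewrite addnS.
  exists ((v, x.+1, false) :: L1), b, L2; split=> // [a|al]; first by rewrite HL.
  by rewrite inE => /orP[/eqP->|/H1].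
(* With [r] empty the height is [(size s).+1], which is odd, so a special step cannot pop [a]. *)
- rewrite addnS /=; case: r => [|v r] /=; first by rewrite os.
  case: ifP => // _ H xx /andP[xv r0].
  have [|L1 [b [L2 [HL H1 H2]]]] := IH x.+1 r _ (leqW xx) r0.
    by rewrite addnS.
  exists ((v, x.+1, true) :: L1), b, L2; split=> // [a|al]; first by rewrite HL.
  by rewrite inE => /orP[/eqP->|/H1].
- rewrite addnS /=; case: r => [|v r] /= H xx.
    move=> _; exists [::], x.+2, (matching_from x.+2 (x.+1 :: s) p).
    split=> // al; apply: leftL2 => [|v]; first by rewrite !leqW.
    by rewrite !inE => /orP[/eqP->|->//]; rewrite ltnS xx orbT.
  move=> /andP[xv r0].
  have [|||L1 [b [L2 [HL H1 H2]]]] := IH x.+2 (x.+1 :: r).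
  + by rewrite /= addSn addnS.
  + by rewrite !leqW.
  + by rewrite /= ltnS xx.
  exists ((v, x.+2, false) :: L1), b, L2; split=> // [a|al].
    by rewrite -cat_cons HL.
  by rewrite inE => /orP[/eqP->|/H1].
Qed.

(** * The effect of flattening on the matching *)

Theorem theorem6 (n : nat) (P : seq step) (c : nat)
    (hP : little_hybrid n P)
    (hspecial : has is_special P)
    (hup : onth P (find is_special P).-1 = Some Up)
    (hc : position P (find is_special P).-1 = c) :
  [/\ position P (find is_special P) = c.+1,
      (c, c.+1, true) \in hybrid_matching P,
      exists! al : edge,
        immediately_nests (hybrid_matching P) al (c, c.+1, true)
    & forall (a b : nat) (t : bool),
        immediately_nests (hybrid_matching P) (a, b, t) (c, c.+1, true) ->
        hybrid_matching (e P) =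
          ((hybrid_matching P `\` [fset (c, c.+1, true); (a, b, t)])
             `|` [fset (c, b, false); (a, c.+1, false)])%fset].
Proof.
have P0 := little_hybrid_end_height hP.
case fk: (find is_special P) hup hc => [|k] /= hup hc.
  (* Here [.-1] truncates: the first step would be both [Up] and [Special]. *)
  have /(nth_find Down) := hspecial; rewrite fk.
  by case: P hup {hP P0 hc fk hspecial} => //= t p [->].
have [PE sk nsk] := leftmost_special hspecial fk hup.
have ePE : e P = take k P ++ HH :: drop k.+2 P by rewrite /e hspecial fk hup.
set A := take k P in PE sk nsk ePE; set B := drop k.+2 P in PE ePE.
have xE : \sum_(t <- A) width t = c.-1 by rewrite -hc.
move: P0; rewrite {1}PE end_height_cat; case Ah: (end_height 0 A) => [h|] //=.
case: ifP => // /[!negbK] oh hB.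
have [||E [s [sh ps matA]]] := @matching_from_prefix A 0 [::] h => //.
rewrite add0n xE in ps matA.
(* The height [h] is odd, so the stack before the upstep has a top [a]. *)
case: s sh ps matA => [|a s] sh ps matA; first by rewrite -sh in oh.
have cE : c.-1.+1 = c by rewrite -hc.
rewrite cE /= in ps; case/andP: ps => ac ps.
have [||//|L1 [b [L2 [matB left1 left2]]]] :=
  @matching_from_pop B c.+1 c.+1 [::] s _ _ (leqnn _).
- by rewrite add0n -/(size (a :: s)) sh.
- by rewrite -[~~ _]/(odd (size (a :: s))) sh.
(* After [Up], [Special] the stack is [a :: s]; after [HH] it is [c :: s]. So [matB] applies to both
   with the same [L1], [b] and [L2]. *)
have MP : matching_from 0 [::] P =
    E ++ (c, c.+1, true) :: L1 ++ (a, b, false) :: L2.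
  by rewrite PE matA /= cE -matB.
have MeP : matching_from 0 [::] (e P) =
    E ++ (a, c.+1, false) :: L1 ++ (c, b, false) :: L2.
  by rewrite ePE matA /= cE -matB.
have := matching_from_right 0 [::] P; rewrite MP => /path_sorted.
rewrite (sorted_pairwise ltn_trans) pairwise_map pairwise_cat pairwise_cons.
rewrite pairwise_cat pairwise_cons allrel_consr all_cat /=.
case/and3P=> /andP[/allP Ec _] _ /andP[/and3P[_ cb _]] /and3P[L1r _].
case/andP=> /allP rL2 _.
have {}L1r : forall al, al \in L1 -> al.1.2 < b.
  by move: L1r; rewrite allrel_consr => /andP[/allP].
have sa v : v \in s -> v < a.
  move: ps; rewrite (path_sortedE (rev_trans ltn_trans)) => /andP[/allP H _].
  exact: H.
have in_MP al : (al \in hybrid_matching P) =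
    [|| al \in E, al == (c, c.+1, true), al \in L1, al == (a, b, false)
      | al \in L2].
  by rewrite in_fset /= MP mem_cat in_cons mem_cat in_cons.
have nest_ab : immediately_nests (hybrid_matching P) (a, b, false) (c, c.+1, true).
  split; rewrite ?in_MP ?eqxx ?orbT //.
  move=> [[u v] t]; rewrite in_MP => alP al_ab [/= lc _ rc].
  (* Edges of [E] end before [c.+1] and those of [L1] start after it. An edge of [L2] around
     [(c, c.+1)] starts in [s], hence before [a], and ends after [b]. *)
  case/or4P: alP => [/Ec/=|/eqP[uE _ _]|/left1/=|/orP[/eqP//|alL2]].
  - by lia.
  - by move: lc; rewrite uE ltnn.
  - by lia.
  - split=> /=; [|by lia|exact: (rL2 _ alL2)].
    by case/orP: (left2 _ alL2) => /= [/sa|]; lia.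
have nest_uniq al : immediately_nests (hybrid_matching P) al (c, c.+1, true) ->
    al = (a, b, false).
  (* Two distinct immediately nesting edges would nest each other. *)
  case: nest_ab => ab _ nab mab [alP _ nal mal].
  apply/eqP; apply/negP => /negP/eqP neq.
  have [/= ? _ _] := mab _ alP neq nal.
  by have [/= ? _ _] := mal _ ab (nesym neq) nab; lia.
split.
- rewrite /position -hc /position /abscissa -/A PE take_cat sk ltnNge leqnSn subSnn /=.
  by rewrite big_cat big_seq1 /= addn1.
- by rewrite in_MP eqxx orbT.
- by exists (a, b, false); split=> // al /nest_uniq.
move=> a' b' t' /nest_uniq[-> -> ->].
apply/fsetP => al; rewrite in_fsetU in_fsetD in_MP !in_fset2 negb_or.
rewrite in_fset /= MeP mem_cat in_cons mem_cat in_cons.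
(* The endpoint bounds separate [E], [L1] and [L2] from both removed edges, so the set difference
   removes nothing else. *)
have nE : al \in E -> (al != (c, c.+1, true)) && (al != (a, b, false)).
  by move=> /Ec /= H; apply/andP; split; apply/eqP => alE; move: H; rewrite alE /=; lia.
have nL1 : al \in L1 -> (al != (c, c.+1, true)) && (al != (a, b, false)).
  move=> alL; have := left1 _ alL; have := L1r _ alL.
  by move=> H H'; apply/andP; split; apply/eqP => alE; move: H H'; rewrite alE /=; lia.
have nL2 : al \in L2 -> (al != (c, c.+1, true)) && (al != (a, b, false)).
  by move=> /rL2 /= H; apply/andP; split; apply/eqP => alE; move: H; rewrite alE /=; lia.
case: (al \in E) nE => [/(_ isT)/andP[-> ->] //|_].
case: (al \in L1) nL1 => [/(_ isT)/andP[-> ->] |_]; first by rewrite !orbT.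
case: (al \in L2) nL2 => [/(_ isT)/andP[-> ->] |_]; first by rewrite !orbT.
case: (al == (c, c.+1, true)); case: (al == (a, b, false)) => //=.
all: by case: (al == (c, b, false)); case: (al == (a, c.+1, false)).
Qed.
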